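(* Let $\mathfrak{T}_m = D_{11}-\sum_j t_jD_{2j}-mD_2$. (1) For a weight vector $\boldsymbol{\omega}$, one has $\mathfrak{T}_1(P_{n,\boldsymbol{\omega}})=0$ for all $n\ge1$ if and only if $2\omega_1=\omega_2$. In particular, whether the sequence $\{P_{n,\boldsymbol\omega}\}_{n\ge1}$ lies in the kernel of $\mathfrak{T}_1$ is completely determined by the first two components $\omega_1,\omega_2$ of the weight vector. (2) Let $a\in\mathbb{Z}$ and let $\boldsymbol{\omega}$ be a weight vector with $\omega_1=\omega_2=a$ such that, for every $n\ge1$, every string $S$ belonging to $P_{n,\boldsymbol{\omega}}$ satisfies $\mathfrak{T}_2(S)=0$. Then $\omega_j=a$ for all $j\ge1$. That is, all such WIP-solutions of $\mathfrak{T}_2=0$ are of the form $P_{n,\boldsymbol{\omega}}=aF_n$ ($n\in\mathbb{N}$), and these solutions are exactly those generated in the WIP-module by the strings belonging to the $F_n$: the sequences $\{P_{n,\boldsymbol\omega}\}_{n\ge1}$ all of whose strings are annihilated by $\mathfrak{T}_2$ are exactly the sequences $\{aF_n\}_{n\ge1}$, $a\in\mathbb{Z}$.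
   Context: Let $t_1,t_2,\ldots$ be indeterminates. Write $D_{ij}=\partial^2/\partial t_i\partial t_j$ and $D_j=\partial/\partial t_j$. The sum over $j$ in the operator is over all indeterminates; only finitely many terms act non-trivially on a given polynomial. An exponent vector is a finitely supported vector $\alpha=(\alpha_1,\alpha_2,\ldots)$ of non-negative integers, and $t^\alpha=\prod_j t_j^{\alpha_j}$. A weight vector is a sequence $\boldsymbol{\omega}=(\omega_1,\omega_2,\ldots)$ of integers. For $n\ge 1$, the weighted isobaric polynomial (WIP) of degree $n$ with weight $\boldsymbol{\omega}$ is $$P_{n,\boldsymbol{\omega}}=\sum_{\alpha} A_\alpha t^\alpha,\qquad A_\alpha=\binom{\sum_j\alpha_j}{\alpha_1\ \alpha_2\ \cdots}\frac{\sum_j\alpha_j\omega_j}{\sum_j\alpha_j},$$ where the sum is over all exponent vectors $\alpha$ with $\sum_j j\alpha_j=n$, and the binomial symbol is the multinomial coefficient $(\sum_j\alpha_j)!/\prod_j\alpha_j!$. The sequences $\{P_{n,\boldsymbol\omega}\}_{n}$ form a $\mathbb{Z}$-module (the WIP-module) under addition of weight vectors. The generalized Fibonacci polynomial $F_n$ is $P_{n,\boldsymbol{\omega}}$ for $\boldsymbol{\omega}=(1,1,1,\ldots)$. Strings: let $\varepsilon\in\{0,1\}$, let $\alpha_2\ge0$ and let $(\alpha_3,\alpha_4,\ldots)$ be a fixed finitely supported tail. The string generated by $(\varepsilon,\alpha_2,\alpha_3,\ldots)$ is the sequence of exponent vectors $(2j+\varepsilon,\alpha_2-j,\alpha_3,\alpha_4,\ldots)$,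 $j=0,1,\ldots,\alpha_2$; all have the same value $n$ of $\sum_i i\alpha_i$. The exponent vectors with $\sum_i i\alpha_i=n$ are partitioned into such strings. The (weighted) string belonging to $P_{n,\boldsymbol{\omega}}$ associated with such a sequence of exponent vectors $\alpha$ (of degree $n$) is the polynomial $S=\sum A_\alpha t^\alpha$, summed over the exponent vectors $\alpha$ of the string with the coefficients $A_\alpha$ of $P_{n,\boldsymbol{\omega}}$. *)

(* Defs.v *)
From HB Require Import structures.
From mathcomp Require Import all_boot all_order all_algebra.
From mathcomp Require Import finmap.
From mathcomp.multinomials Require Import monalg.
From mathcomp Require Import zify.

Set Implicit Arguments.
Unset Strict Implicit.
Unset Printing Implicit Defensive.

Import GRing.Theory.

Local Open Scope fset_scope.
Local Open Scope ring_scope.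

(* Indices are shifted by one throughout, as in monalg's [mnmwgt]: the index  *)
(* j : nat stands for j + 1, so [tvar 0] is t_1, [alpha 0] is alpha_1,        *)
(* [omega 1] is omega_2, and [pderiv 1] is D_2.                               *)
Definition expvec := {cmonom nat}.
Definition tpoly := {malg rat[{cmonom nat}]}.
Definition weight := nat -> int.

Definition tvar (j : nat) : tpoly := << ucm j >>.

Definition isodeg (a : expvec) : nat := (\sum_(j <- finsupp a) j.+1 * a j)%N.

Definition pderiv (i : nat) (p : tpoly) : tpoly :=
  \sum_(a <- msupp p) << p@_a *+ a i *g divcm a (ucm i) >>.

Definition vars (p : tpoly) : {fset nat} :=
  \bigcup_(a <- msupp p) finsupp a.

(* The sum over all indeterminates reduces to those occurring in p, as        *)
(* [pderiv j p = 0] for every other j (lemma [pderiv_notin_vars] below).      *)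
Definition opT (m : int) (p : tpoly) : tpoly :=
  pderiv 0 (pderiv 0 p)
  - \sum_(j <- vars p) tvar j * pderiv 1 (pderiv j p)
  - m%:~R *: pderiv 1 p.

Definition multinom (a : expvec) : rat :=
  (mdeg a)`!%:R / (\prod_(j <- finsupp a) (a j)`!)%:R.

Definition wipcoef (omega : weight) (a : expvec) : rat :=
  multinom a * ((\sum_(j <- finsupp a) (a j)%:Z * omega j)%:~R / (mdeg a)%:R).

(* If [isodeg a = n] then a has entries at most n, and they vanish from index *)
(* n on; hence the enumeration of the exponent vectors of degree n through    *)
(* {ffun 'I_n -> 'I_n.+1}.  See lemma [mem_isovecs].                          *)
Definition boxvec (n : nat) (f : {ffun 'I_n -> 'I_n.+1}) : expvec :=
  [cmonom oapp (fun k => f k : nat) 0%N (insub i) | i in seq_fset tt (iota 0 n)]%M.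

Definition isovecs (n : nat) : {fset expvec} :=
  [fset a in [seq boxvec f | f : {ffun 'I_n -> 'I_n.+1}] | isodeg a == n].

Definition WIP (omega : weight) (n : nat) : tpoly :=
  \sum_(a <- isovecs n) << wipcoef omega a *g a >>.

Definition genFib (n : nat) : tpoly := WIP (fun=> 1) n.

(* The exponent vector (2 j + e, b - j, tail_0, tail_1, ...), so [tail i]     *)
(* stands for alpha_(i+3).                                                    *)
Definition stringvec (e : bool) (b : nat) (tail : expvec) (j : nat) : expvec :=
  [cmonom match i with
          | 0 => 2 * j + e
          | 1 => b - j
          | i'.+2 => tail i'
          end%N
   | i in 0%N |` (1%N |` [fset i.+2 | i in finsupp tail])]%M.

Definition wstring (omega : weight) (e : bool) (b : nat) (tail : expvec) :
    tpoly :=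
  \sum_(j < b.+1)
    << wipcoef omega (stringvec e b tail j) *g stringvec e b tail j >>.

(* The degree is read off the first vector of the string; all the others have *)
(* the same one (lemma [isodeg_stringvec]).                                   *)
Definition is_string (omega : weight) (n : nat) (S : tpoly) : Prop :=
  exists e b tail,
    isodeg (stringvec e b tail 0) = n /\ S = wstring omega e b tail.

Definition in_kernel (m : int) (u : nat -> tpoly) : Prop :=
  forall n, (0 < n)%N -> opT m (u n) = 0.

Definition strings_in_kernel (m : int) (omega : weight) : Prop :=
  forall n, (0 < n)%N -> forall S, is_string omega n S -> opT m S = 0.

Lemma pderiv_notin_vars (p : tpoly) (i : nat) : i \notin vars p -> pderiv i p = 0.
Proof.
move=> ip; rewrite /pderiv big_seq big1 // => a ap.
suff -> : a i = 0%N by rewrite mulr0n monalgU0.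
apply/eqP; rewrite cmE_eq0; apply: contra ip => ia.
by apply/bigfcupP; exists a => //; rewrite ap.
Qed.

Lemma isodegEw (a : expvec) (d : {fset nat}) :
  finsupp a `<=` d -> isodeg a = (\sum_(j <- d) j.+1 * a j)%N.
Proof.
move=> sd; rewrite /isodeg (big_fset_incl _ sd) // => j _.
by rewrite -cmE_eq0 => /eqP->; rewrite muln0.
Qed.

Lemma boxvecE n (f : {ffun 'I_n -> 'I_n.+1}) i :
  boxvec f i = oapp (fun k => f k : nat) 0%N (insub i).
Proof.
rewrite /boxvec cmE fsfunE; case: ifP => //.
by rewrite seq_fsetE mem_iota /= add0n => /negbT ni; rewrite insubN.
Qed.

Lemma mem_isovecs n (a : expvec) : (a \in isovecs n) = (isodeg a == n).
Proof.
rewrite !inE /= andbC; case: eqP => //= dega.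
have lea j : (j.+1 * a j <= n)%N.
  have [ja|/negbTE ja] := boolP (j \in finsupp a); last first.
    by move/negbT: ja; rewrite -cmE_eq0 => /eqP->; rewrite muln0.
  by rewrite -dega /isodeg (big_fsetD1 j) //= leq_addr.
have lea1 j : (a j < n.+1)%N.
  by rewrite ltnS (leq_trans _ (lea j)) // leq_pmull.
apply/imageP; exists [ffun k : 'I_n => Ordinal (lea1 k)] => //.
apply/eqP/cmP => i; rewrite boxvecE; case: insubP => [k _ <-|] /=.
  by rewrite ffunE.
rewrite -leqNgt => ni; apply/eqP; rewrite -leqn0 leqNgt; apply/negP => ai.
by have := leq_trans (leq_pmulr i.+1 ai) (lea i); rewrite ltnNge ni.
Qed.

Lemma mcoeff_sumU (s : {fset expvec}) (F : expvec -> rat) (a : expvec) :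
  (\sum_(b <- s) << F b *g b >> : tpoly)@_a = if a \in s then F a else 0.
Proof.
rewrite raddf_sum /=; have [an|an] := boolP (a \in s).
  rewrite (big_fsetD1 a an) big_seq big1 => [|b].
    by rewrite /= addr0 mcoeffUU.
  by rewrite !inE => /andP[/negbTE ba _]; rewrite mcoeffU ba.
rewrite big_seq big1 // => b bn; rewrite mcoeffU.
by case: eqP an => // <-; rewrite bn.
Qed.

Lemma mcoeff_WIP omega n (a : expvec) :
  (WIP omega n)@_a = if isodeg a == n then wipcoef omega a else 0.
Proof. by rewrite -mem_isovecs -mcoeff_sumU. Qed.

Lemma stringvecE e b (tail : expvec) j i :
  stringvec e b tail j i =
  (match i with 0 => 2 * j + e | 1 => b - j | i'.+2 => tail i' end)%N.
Proof.
rewrite /stringvec cmE fsfunE; case: ifPn => //.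
case: i => [|[|i]]; rewrite !inE //= => it; apply/esym/eqP.
by rewrite cmE_eq0; apply: contra it => it; apply/imfsetP; exists i.
Qed.

Lemma isodeg_stringvec e b (tail : expvec) j : (j <= b)%N ->
  isodeg (stringvec e b tail j) = isodeg (stringvec e b tail 0).
Proof.
move=> jb; pose d : {fset nat} := [fset i.+2 | i in finsupp tail].
have sd k : finsupp (stringvec e b tail k) `<=` 0%N |` (1%N |` d).
  apply/fsubsetP => i; rewrite -cmE_neq0 stringvecE !inE.
  case: i => [|[|i]] //=; rewrite cmE_neq0 => it.
  by apply/imfsetP; exists i.
have n1 : 1%N \notin d by apply/imfsetP => -[].
have n0 : 0%N \notin 1%N |` d by rewrite !inE /=; apply/imfsetP => -[].
rewrite !(isodegEw (sd _)) !big_fsetU1 //= !stringvecE.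
have eqd : (\sum_(i <- d) i.+1 * stringvec e b tail j i
          = \sum_(i <- d) i.+1 * stringvec e b tail 0 i)%N.
  by apply: eq_big_seq => i /imfsetP[k _ ->]; rewrite !stringvecE.
rewrite eqd !addnA; congr addn; lia.
Qed.

(* Main.v *)
(* Write |b| for the total degree of b and <b, w> for \sum_j b_j w_j.         *)
(* Comparing coefficients of t^b, the sum over all t_j D_{2j} acts on t^b as  *)
(* multiplication by |b| after D_2 (Euler), and the operator with parameter m *)
(* sends the weighted polynomial to the one with coefficients                 *)
(*   multinom b * ((|b| + 1) (<b, w> + 2 w_1) - (|b| + m) (<b, w> + w_2)).    *)
(* For m = 1 the bracket is (|b| + 1) (2 w_1 - w_2).  For m = 2, b = 0 gives  *)
(* w_1 = w_2 and then b = e_j gives w_j = w_1.  Strings behave like the full  *)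
(* polynomial since b + 2 e_1 and b + e_2 always lie in the same string.      *)
Require Import Defs.
From HB Require Import structures.
From mathcomp Require Import all_boot all_order all_algebra.
From mathcomp Require Import finmap.
From mathcomp.multinomials Require Import monalg.
From mathcomp Require Import zify ring.

Import GRing.Theory Num.Theory.

Local Open Scope fset_scope.
Local Open Scope ring_scope.

(** The kernel condition is tested one coefficient at a time. By [mcoeff_opT] the coefficient at b
    involves only the coefficients of p at t_1^2 t^b and t_2 t^b, and [wipcoefMU] turns both into
    multiples of the nonzero number [multinom b]. What remains ([opT_wip_eq0]) is an integer
    identity in b and omega that mentions neither a degree nor a string. Since every monomial lies
    in some string, letting all strings vary yields this identity for every b
    ([strings_in_kernelP]). *)

Local Notation "1" := mone : monom_scope.
Local Notation "x * y" := (mmul x y) : monom_scope.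

(** * Multiplying a monomial by one indeterminate *)

Lemma big_expvecD1 {V : Type} {idx : V} (op : Monoid.com_law idx)
    (F : nat -> nat -> V) (b : expvec) (i : nat) :
  (forall j, F j 0%N = idx) ->
  \big[op/idx]_(j <- finsupp b) F j (b j)
  = op (F i (b i)) (\big[op/idx]_(j <- finsupp b `\ i) F j (b j)).
Proof.
move=> F0; case: (mdomP b i) => ib; first exact: big_fsetD1.
rewrite F0 Monoid.mul1m; by rewrite mem_fsetD1.
Qed.

(** With [big_expvecD1], this isolates index i whether or not it lies in the support of b, leaving
    the same remainder for b and b * ucm i. *)
Lemma big_expvecMU {V : Type} {idx : V} (op : Monoid.com_law idx)
    (F : nat -> nat -> V) (b : expvec) (i : nat) :
  (forall j, F j 0%N = idx) ->
  \big[op/idx]_(j <- finsupp (b * ucm i)%M) F j ((b * ucm i)%M j)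
  = op (F i (b i).+1) (\big[op/idx]_(j <- finsupp b `\ i) F j (b j)).
Proof.
move=> F0; rewrite (big_expvecD1 _ _ _ i F0) cmM cmUU addn1; congr (op _ _).
rewrite mdomD mdomU fsetDUl fsetDv fsetU0.
apply: eq_big_seq => j; rewrite !inE => /andP[ji _].
by rewrite cmM cmU eq_sym (negbTE ji) addn0.
Qed.

Lemma isodegMU (b : expvec) (i : nat) :
  isodeg (b * ucm i)%M = (isodeg b + i.+1)%N.
Proof.
rewrite /isodeg.
rewrite (big_expvecMU _ (fun j k => j.+1 * k)%N); last by move=> j; rewrite muln0.
rewrite (big_expvecD1 _ (fun j k => j.+1 * k)%N b i) /=; first by lia.
by move=> j; rewrite muln0.
Qed.

Definition wdeg (omega : weight) (a : expvec) : int :=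
  \sum_(j <- finsupp a) (a j)%:Z * omega j.

Lemma wdeg1 omega : wdeg omega 1%M = 0.
Proof. by rewrite /wdeg mdom1 big_seq_fset0. Qed.

Lemma wdegMU omega (b : expvec) (i : nat) :
  wdeg omega (b * ucm i)%M = wdeg omega b + omega i.
Proof.
rewrite /wdeg.
rewrite (big_expvecMU _ (fun j k => k%:Z * omega j)); last first.
  by move=> j; rewrite mul0r.
rewrite (big_expvecD1 _ (fun j k => k%:Z * omega j) b i) /=.
  by rewrite intS; ring.
by move=> j; rewrite mul0r.
Qed.

Lemma wdeg_const omega c (a : expvec) :
  (forall j, omega j = c) -> wdeg omega a = (mdeg a)%:Z * c.
Proof.
move=> oc; rewrite /wdeg mdegE (big_morph Posz PoszD (erefl _)) mulr_suml.
by apply: eq_bigr => j _; rewrite oc.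
Qed.

Lemma mdegMU (b : expvec) (i : nat) : mdeg (b * ucm i)%M = (mdeg b).+1.
Proof. by rewrite mdegM mdegU addn1. Qed.

Lemma multinomMU (b : expvec) (i : nat) :
  multinom (b * ucm i)%M * (b i).+1%:R = multinom b * (mdeg b).+1%:R.
Proof.
rewrite /multinom mdegMU factS.
rewrite (big_expvecMU _ (fun _ k => k`!)) //.
rewrite (big_expvecD1 _ (fun _ k => k`!) b i) //= factS !natrM.
have fact_neq0 k : k`!%:R != 0 :> rat by rewrite pnatr_eq0 -lt0n fact_gt0.
have prod_neq0 : (\prod_(j <- finsupp b `\ i) (b j)`!)%:R != 0 :> rat.
  by rewrite natr_prod prodf_seq_neq0; apply/allP => j _; rewrite fact_neq0.
by field; rewrite prod_neq0 fact_neq0 addrC natr1 pnatr_eq0.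
Qed.

Lemma multinom_neq0 (b : expvec) : multinom b != 0.
Proof.
rewrite mulf_neq0 ?invr_neq0 ?pnatr_eq0 -?lt0n ?fact_gt0 //.
by rewrite prodn_gt0 // => j; rewrite fact_gt0.
Qed.

(** The factor |b| + 1 gained by the multinomial cancels the denominator of A_alpha; the factor b_i
    + 1 on the left is the one D_i produces. *)
Lemma wipcoefMU omega (b : expvec) (i : nat) :
  wipcoef omega (b * ucm i)%M * (b i).+1%:R
  = multinom b * (wdeg omega b + omega i)%:~R.
Proof.
rewrite /wipcoef -/(wdeg omega _) mulrAC multinomMU wdegMU mdegMU -mulrA.
by rewrite [_.+1%:R * _]mulrC divfK // pnatr_eq0.
Qed.

(** * Coefficients of derivatives and of the operator *)

Lemma mcoeff_sum_pick (p : tpoly) (c : expvec) :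
  \sum_(a <- msupp p) p@_a *+ (a == c) = p@_c.
Proof.
rewrite [in RHS](monalgE p) raddf_sum /=.
by apply: eq_bigr => a _; rewrite mcoeffU.
Qed.

Lemma mcoeff_pderiv (i : nat) (p : tpoly) (b : expvec) :
  (pderiv i p)@_b = p@_(b * ucm i)%M *+ (b i).+1.
Proof.
rewrite /pderiv raddf_sum /= -mcoeff_sum_pick -sumrMnl.
apply: eq_bigr => a _; rewrite mcoeffU; have [->|ab] := eqVneq a (b * ucm i)%M.
  suff -> : divcm (b * ucm i)%M (ucm i) = b by rewrite eqxx cmM cmUU addn1.
  by apply/eqP/cmP => j; rewrite divcmE cmM addnK.
(* If a_i = 0, [divcm] truncates and may still return b, but the factor a_i kills the term. *)
rewrite mul0rn; case ai: (a i) => [|k]; first by rewrite mulr0n mul0rn.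
case: eqP => // ab'; case/eqP: ab; apply/eqP/cmP => j.
rewrite -ab' cmM divcmE cmU; case: eqVneq => [<-|_]; last by rewrite subn0 addn0.
by rewrite ai; lia.
Qed.

Lemma mcoeff_euler (j : nat) (p : tpoly) (b : expvec) :
  (tvar j * pderiv j p)@_b = p@_b *+ b j.
Proof.
rewrite malgM_def fgmulUg raddf_sum /=.
case bj: (b j) => [|k].
  rewrite mulr0n big1 // => a _; rewrite mcoeffU.
  case: eqP => // /(congr1 (fun c : expvec => c j)).
  by rewrite cmM cmUU bj.
pose c : expvec := divcm b (ucm j).
have bE : b = (ucm j * c)%M.
  apply/eqP/cmP => i; rewrite cmM divcmE cmU.
  by case: eqVneq => [<-|_]; rewrite ?subn0 // bj; lia.
transitivity (\sum_(a <- msupp (pderiv j p)) (pderiv j p)@_a *+ (a == c)).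
  apply: eq_bigr => a _; rewrite mcoeffU mul1r; congr (_ *+ _).
  congr nat_of_bool; apply/eqP/eqP => [|->//].
  move=> ab; apply/eqP/cmP => i; move/(congr1 (fun d : expvec => d i)): ab.
  by rewrite [in RHS]bE !cmM => /addnI.
rewrite mcoeff_sum_pick mcoeff_pderiv mulmC -bE divcmE cmUU bj.
by rewrite subn1.
Qed.

Lemma mcoeff_pderiv2 (i j : nat) (p : tpoly) (b : expvec) :
  (pderiv i (pderiv j p))@_b
  = p@_(b * ucm i * ucm j)%M *+ ((b j + (i == j)).+1 * (b i).+1).
Proof. by rewrite mcoeff_pderiv mcoeff_pderiv cmM cmU mulrnA. Qed.

Lemma pderivC (i j : nat) (p : tpoly) :
  pderiv i (pderiv j p) = pderiv j (pderiv i p).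
Proof.
apply/malgP => b.
apply: etrans (mcoeff_pderiv2 i j p b) (etrans _ (esym (mcoeff_pderiv2 j i p b))).
rewrite -[mmul (mmul b (ucm i)) _]mulmA [mmul (ucm i) _]mulmC mulmA eq_sym.
by case: eqVneq => [->|_]; rewrite ?addn0 // mulnC.
Qed.

Lemma mcoeff_opT (m : int) (p : tpoly) (b : expvec) :
  (opT m p)@_b
  = p@_(b * ucm 0%N * ucm 0%N)%M *+ ((b 0%N).+2 * (b 0%N).+1)
    - p@_(b * ucm 1%N)%M * (b 1%N).+1%:R * ((mdeg b)%:Z + m)%:~R.
Proof.
(* Stated with variables because rewriting in [opT m p] itself makes the      *)
(* unifier unfold and compare the derivatives, which does not terminate.      *)
have coefE (x y z : tpoly) X Y Z : x@_b = X -> y@_b = Y -> z@_b = Z ->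
    (x - y - m%:~R *: z)@_b = X - Y - m%:~R * Z.
  by move=> <- <- <-; rewrite !mcoeffB mcoeffZ.
have D11 := mcoeff_pderiv2 0 0 p b; rewrite eqxx addn1 in D11.
have Euler : (\sum_(j <- vars p) tvar j * pderiv 1 (pderiv j p))@_b
    = p@_(b * ucm 1%N)%M *+ (b 1%N).+1 *+ \sum_(j <- vars p) b j.
  rewrite raddf_sum /= -mcoeff_pderiv -sumrMnr.
  by apply: eq_bigr => j _; rewrite pderivC mcoeff_euler.
rewrite /opT (coefE _ _ _ _ _ _ D11 Euler (mcoeff_pderiv 1 p b)) -addrA; congr (_ + _).
(* The support of b is known to lie in [vars p] only when t_2 t^b occurs in p; otherwise both sides
   vanish. *)
have [->|p0] := eqVneq p@_(b * ucm 1%N)%M 0.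
  by rewrite !mul0rn mulr0 !mul0r subr0.
have sb : finsupp b `<=` vars p.
  apply/fsubsetP => j jb; apply/bigfcupP; exists (b * ucm 1%N)%M.
    by rewrite andbT -mcoeff_neq0.
  by rewrite mdomD in_fsetU jb.
rewrite -(mdegEw sb) intrD -pmulrn.
rewrite -[X in - X]mulr_natr -[_ *+ (b 1%N).+1]mulr_natr; ring.
Qed.

(* Both [WIP omega n] and the strings are of this form, [s] being their set   *)
(* of exponent vectors; the exponents of D_11 p and D_2 p that contribute to  *)
(* the coefficient of t^b lie in [s] simultaneously.                          *)
Lemma opT_wip_eq0 (m : int) omega (p : tpoly) (s : pred expvec) :
  (forall a, p@_a = if s a then wipcoef omega a else 0) ->
  (forall b, s (b * ucm 0%N * ucm 0%N)%M = s (b * ucm 1%N)%M) ->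
  opT m p = 0 <->
  forall b, s (b * ucm 1%N)%M ->
    ((mdeg b).+1%:Z * (wdeg omega b + 2 * omega 0%N)
     = ((mdeg b)%:Z + m) * (wdeg omega b + omega 1%N))%R.
Proof.
move=> ps s01.
have coefE b : (opT m p)@_b = if s (b * ucm 1%N)%M then
    multinom b * ((mdeg b).+1%:Z * (wdeg omega b + 2 * omega 0%N)
     - ((mdeg b)%:Z + m) * (wdeg omega b + omega 1%N))%:~R else 0.
  rewrite mcoeff_opT !ps s01; case: ifP => _; last by rewrite mul0rn !mul0r subr0.
  have := wipcoefMU omega (b * ucm 0%N)%M 0%N; rewrite cmM cmUU addn1 => W0.
  rewrite wipcoefMU -[X in X - _]mulr_natr [(_ * _)%:R]natrM mulrA W0.
  rewrite mulrAC multinomMU wdegMU; ring.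
split=> [T0 b sb|H].
  have := coefE b; rewrite T0 mcoeff0 sb => /esym/eqP.
  by rewrite mulf_eq0 (negbTE (multinom_neq0 b)) intr_eq0 subr_eq0 => /eqP.
apply/malgP => b; rewrite coefE mcoeff0; case: ifP => // sb.
by rewrite (H b sb) subrr mulr0.
Qed.

Lemma opT1_WIP omega : in_kernel 1 (WIP omega) <-> 2 * omega 0%N = omega 1%N.
Proof.
have iso01 n b : (isodeg (b * ucm 0%N * ucm 0%N)%M == n)
               = (isodeg (b * ucm 1%N)%M == n).
  by rewrite !isodegMU -addnA.
have WIP0 n := opT_wip_eq0 1 omega _ _ (mcoeff_WIP omega n) (iso01 n).
split=> [K|o01 n _].
  (* The constant term in degree 2, where only t_1^2 and t_2 occur, already forces the relation. *)
  have /WIP0/(_ 1%M) := K 2 isT.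
  rewrite isodegMU mdeg1 wdeg1 /isodeg mdom1 big_seq_fset0 => /(_ isT).
  by rewrite !add0r !mul1r.
by apply/WIP0 => b _; rewrite o01; congr (_ * _); lia.
Qed.

(** * Strings *)

Lemma mcoeff_wstring omega e b (tail a : expvec) :
  (wstring omega e b tail)@_a
  = if [exists j : 'I_b.+1, stringvec e b tail j == a]
    then wipcoef omega a else 0.
Proof.
rewrite /wstring raddf_sum /=.
under eq_bigr => j _ do rewrite mcoeffU.
case: existsP => [[j /eqP ja]|na].
  (* The vectors of a string are distinct: the first entry 2j + e determines j. *)
  rewrite (bigD1 j) //= ja eqxx mulr1n big1 ?addr0 // => k kj.
  case: eqP => // ka; case/eqP: kj; apply: val_inj => /=.
  have := congr1 (fun c : expvec => c 0%N) (etrans ka (esym ja)).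
  by rewrite !stringvecE; lia.
rewrite big1 // => j _; case: eqP => // ja.
by case: na; exists j; apply/eqP.
Qed.

(** Trading t_2 for t_1^2 moves one step along the string. The neighbour exists: a t_1-exponent of
    at least 2 forces j > 0 since e <= 1, and a positive t_2-exponent forces j < b. *)
Lemma stringvec_shift e b (tail c : expvec) :
  [exists j : 'I_b.+1, stringvec e b tail j == (c * ucm 0%N * ucm 0%N)%M]
  = [exists j : 'I_b.+1, stringvec e b tail j == (c * ucm 1%N)%M].
Proof.
apply/existsP/existsP => -[j /eqP jc].
  have jci i := congr1 (fun d : expvec => d i) jc.
  have j1 : (j.-1 < b.+1)%N by have := ltn_ord j; lia.
  exists (Ordinal j1); apply/eqP/eqP/cmP => i.
  have := jci i; have := jci 0%N; rewrite !cmM !cmU !stringvecE /=.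
  by case: i => [|[|i]] /=; have := ltn_ord j; lia.
have jci i := congr1 (fun d : expvec => d i) jc.
have j1 : (j.+1 < b.+1)%N.
  by have := jci 1%N; rewrite !cmM !cmU !stringvecE /=; lia.
exists (Ordinal j1); apply/eqP/eqP/cmP => i.
have := jci i; have := jci 1%N; rewrite !cmM !cmU !stringvecE /=.
by case: i => [|[|i]] /=; have := ltn_ord j; lia.
Qed.

(** The parity of the t_1-exponent is e, its half is the position j, and adding j to the
    t_2-exponent recovers the start of the string. *)
Lemma stringvec_onto (a : expvec) :
  exists e b tail j, (j <= b)%N /\ a = stringvec e b tail j.
Proof.
pose tail : expvec :=
  [cmonom a i.+2 | i in [fset k.-2 | k in finsupp a]]%M.
have tailE i : tail i = a i.+2.
  rewrite cmE fsfunE; case: ifPn => // ia; apply/esym/eqP; rewrite cmE_eq0.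
  by apply: contra ia => ia; apply/imfsetP; exists i.+2.
exists (odd (a 0%N)), (a 1%N + (a 0%N)./2)%N, tail, (a 0%N)./2.
split; first exact: leq_addl.
apply/eqP/cmP => -[|[|i]]; rewrite stringvecE ?tailE ?addnK //.
by rewrite addnC mul2n odd_double_half.
Qed.

Lemma strings_in_kernelP (m : int) omega :
  strings_in_kernel m omega <->
  forall b : expvec,
    ((mdeg b).+1%:Z * (wdeg omega b + 2 * omega 0%N)
     = ((mdeg b)%:Z + m) * (wdeg omega b + omega 1%N))%R.
Proof.
have S0 e b tail := opT_wip_eq0 m omega _ _ (mcoeff_wstring omega e b tail)
  (stringvec_shift e b tail).
split=> [K b|H n n0 S [e [b [tail [_ ->]]]]]; last by apply/S0 => c _.
have [e [k [tail [j [jk bE]]]]] := stringvec_onto (b * ucm 1%N)%M.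
have n0 : (0 < isodeg (stringvec e k tail 0))%N.
  by rewrite -(isodeg_stringvec e tail jk) -bE isodegMU addnS.
have /S0/(_ b) := K _ n0 _ (ex_intro _ e (ex_intro _ k (ex_intro _ tail
  (conj erefl erefl)))).
by apply; apply/existsP; exists (Ordinal (jk : j < k.+1)%N); rewrite /= bE.
Qed.

(** * Parameter m = 2 and constant weights *)

Lemma strings_in_kernel2_const omega :
  strings_in_kernel 2 omega <-> forall j, omega j = omega 0%N.
Proof.
split=> [/strings_in_kernelP K j|oc].
  have := K 1%M; have := K (ucm j).
  have -> : ucm j = (1 * ucm j)%M by rewrite mul1m.
  rewrite wdegMU wdeg1 mdegMU mdeg1; lia.
apply/strings_in_kernelP => b; rewrite (wdeg_const _ _ _ oc) (oc 1%N).
by rewrite intS; ring.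
Qed.

Lemma WIP_const omega (a : int) n :
  (forall j, omega j = a) -> WIP omega n = genFib n *~ a.
Proof.
move=> oa; apply/malgP => b; apply: etrans (mcoeff_WIP _ _ _) _.
apply: etrans (esym (raddfMz (mcoeff b) a (genFib n))); rewrite /= /genFib mcoeff_WIP.
case: ifP => _; last by rewrite mul0rz.
rewrite /wipcoef -!/(wdeg _ b) (wdeg_const _ _ _ oa).
rewrite (wdeg_const _ _ _ (fun=> erefl)) -mulrzr !intrM; ring.
Qed.

Theorem corollary4p2 :
  (forall omega : weight,
      in_kernel 1 (WIP omega) <-> 2 * omega 0%N = omega 1%N)
  /\ (forall omega omega' : weight,
      omega 0%N = omega' 0%N -> omega 1%N = omega' 1%N ->
      (in_kernel 1 (WIP omega) <-> in_kernel 1 (WIP omega')))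
  /\ (forall (a : int) (omega : weight),
      omega 0%N = a -> omega 1%N = a -> strings_in_kernel 2 omega ->
      (forall j : nat, omega j = a)
      /\ (forall n : nat, (0 < n)%N -> WIP omega n = genFib n *~ a))
  /\ (forall u : nat -> tpoly,
      (exists omega : weight,
          (forall n : nat, (0 < n)%N -> u n = WIP omega n)
          /\ strings_in_kernel 2 omega)
      <-> (exists a : int, forall n : nat, (0 < n)%N -> u n = genFib n *~ a)).
Proof.
split; first exact: opT1_WIP.
split=> [omega omega' o0 o1|].
  by split=> /opT1_WIP ker; apply/opT1_WIP; lia.
split=> [a omega <- _ /strings_in_kernel2_const oc|u].
  by split=> // n _; exact: WIP_const.
split=> [[omega [uE /strings_in_kernel2_const oc]]|[a uE]].
  by exists (omega 0%N) => n n0; rewrite uE //; exact: WIP_const.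
exists (fun=> a); split; last exact/strings_in_kernel2_const.
by move=> n n0; rewrite uE // (WIP_const (fun=> a) a).
Qed.
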